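(* Let $G$ be a group with identity $e$ and let $R=\bigoplus_{g\in G}R_g$ be a $G$-graded commutative ring. The following statements are equivalent: (1) $R$ is a Gelfand graded ring; (2) for every $a\in R_e$ there exist elements $b,c\in R_e$ such that $(1-ba)(1-ca')=0$, where $a'=1-a$.
   Context: A commutative ring $R$ with unit is $G$-graded if $R=\bigoplus_{g\in G}R_g$ with additive subgroups $R_g$ satisfying $R_gR_{g'}\subseteq R_{gg'}$; $h(R)=\bigcup_{g\in G}R_g$ is the set of homogeneous elements. An ideal $I$ is graded if $I=\bigoplus_{g\in G}(I\cap R_g)$. A homogeneous prime ideal is a graded ideal $P\neq R$ such that for all $r,s\in h(R)$, $rs\in P$ implies $r\in P$ or $s\in P$. A graded maximal ideal is a graded ideal that is maximal among proper graded ideals. $R$ is called a Gelfand ($G$-)graded ring if every homogeneous prime ideal of $R$ is contained in a unique graded maximal ideal of $R$. *)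

(* Defs.v *)
From HB Require Import structures.
From mathcomp Require Import all_boot all_order all_algebra finmap.
From mathcomp Require Import boolp classical_sets.

Set Implicit Arguments.
Unset Strict Implicit.
Unset Printing Implicit Defensive.

Import GRing.Theory.

Local Open Scope classical_set_scope.
Local Open Scope ring_scope.

(* [I] is the internal direct sum of the [A g]: the index set [G] may be
   infinite, so decompositions are finitely supported families. *)
Definition is_direct_sum (G : choiceType) (V : nmodType) (A : G -> set V)
    (I : set V) : Prop :=
  (forall g, A g `<=` I) /\
  forall x, I x -> exists! f : {fsfun G -> V with 0},
    (forall g, A g (f g)) /\ x = \sum_(g <- finsupp f) f g.

Record is_grading (G : groupType) (R : comPzRingType) (A : G -> set R) : Prop :=
  IsGrading {
    grading_zmod : forall g, zmod_closed [in A g];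
    grading_mul : forall g h r s, A g r -> A h s -> A (g * h)%g (r * s);
    grading_sum : is_direct_sum A [set: R]
  }.

Definition homogeneous (G : groupType) (R : comPzRingType) (A : G -> set R) :
  set R := \bigcup_(g in [set: G]) A g.

(* Unlike [idealr_closed] and the other ideal predicates of [ring_quotient],
   this allows the unit ideal and the zero ring. *)
Definition is_ideal (R : comPzRingType) (I : set R) : Prop :=
  zmod_closed [in I] /\ forall r x, I x -> I (r * x).

Definition graded_ideal (G : groupType) (R : comPzRingType) (A : G -> set R)
    (I : set R) : Prop :=
  is_ideal I /\ is_direct_sum (fun g => I `&` A g) I.

Definition homogeneous_prime (G : groupType) (R : comPzRingType)
    (A : G -> set R) (P : set R) : Prop :=
  [/\ graded_ideal A P, P <> [set: R] &
      forall r s, homogeneous A r -> homogeneous A s -> P (r * s) ->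
        P r \/ P s].

Definition graded_maximal (G : groupType) (R : comPzRingType)
    (A : G -> set R) (M : set R) : Prop :=
  [/\ graded_ideal A M, M <> [set: R] &
      forall J, graded_ideal A J -> J <> [set: R] -> M `<=` J -> J = M].

Definition gelfand_graded (G : groupType) (R : comPzRingType)
    (A : G -> set R) : Prop :=
  forall P, homogeneous_prime A P ->
    exists! M : set R, graded_maximal A M /\ P `<=` M.

(* Main.v *)
Require Import Defs.
From HB Require Import structures.
From mathcomp Require Import all_boot all_order all_algebra finmap ring.
From mathcomp Require Import boolp classical_sets.

Set Implicit Arguments.
Unset Strict Implicit.
Unset Printing Implicit Defensive.

Import GRing.Theory.

Local Open Scope classical_set_scope.
Local Open Scope ring_scope.

(** For (2) => (1): if two distinct graded maximal ideals M1, M2 contain the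
    homogeneous prime P, the degree-e component of a decomposition of 1 in
    M1 + M2 gives a in M1 with 1 - a in M2; then one of the degree-e factors
    1 - ba, 1 - ca' lies in P, hence M1 or M2 contains 1.
    For (1) => (2): the products (1 - ba)(1 - ca') with b, c in R_e form a
    multiplicatively closed set S. If 0 is not in S, a graded ideal P maximal
    among those avoiding S is a homogeneous prime, and both P + Ra and P + Ra'
    are proper (otherwise P contains some 1 - ba or 1 - ca'). The graded maximal
    ideals above them coincide by (1), so they contain a + a' = 1. *)

(** * Ideals as sets, their sums, and principal ideals *)

Lemma zmod_closed_setP (V : zmodType) (I : set V) :
  zmod_closed [in I] <-> I 0 /\ (forall x y, I x -> I y -> I (x - y)).
Proof.
split=> -[I0 IB]; split.
- exact: set_mem I0.
- by move=> x y Ix Iy; apply: set_mem; apply: IB; apply: mem_set.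
- exact: mem_set.
- by move=> x y /set_mem Ix /set_mem Iy; apply: mem_set; apply: IB.
Qed.

Section GradedRing.
Context (G : groupType) (R : comPzRingType) (A : G -> set R).
Implicit Types (g h : G) (x y r s : R) (I J P M S : set R).

Lemma ideal0 I : is_ideal I -> I 0.
Proof. by case=> /zmod_closed_setP[]. Qed.

Lemma idealB I x y : is_ideal I -> I x -> I y -> I (x - y).
Proof. by case=> /zmod_closed_setP[_ IB] _; apply: IB. Qed.

Lemma idealD I x y : is_ideal I -> I x -> I y -> I (x + y).
Proof.
move=> II Ix Iy; rewrite -[y]opprK -[- y]sub0r; do 2?apply: idealB => //.
exact: ideal0.
Qed.

Lemma idealMl I r x : is_ideal I -> I x -> I (r * x).
Proof. by case=> _; apply. Qed.

Lemma ideal1 I : is_ideal I -> I 1 -> I = [set: R].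
Proof.
by move=> II I1; apply/seteqP; split=> // x _; rewrite -[x]mulr1;
  apply: idealMl.
Qed.

Definition ideal_add I J : set R :=
  [set x | exists y z, [/\ I y, J z & x = y + z]].

Lemma is_ideal_add I J : is_ideal I -> is_ideal J -> is_ideal (ideal_add I J).
Proof.
move=> II IJ; split; first apply/zmod_closed_setP; first split.
- by exists 0, 0; rewrite addr0; split=> //; apply: ideal0.
- move=> _ _ [y [z [Iy Jz ->]]] [y' [z' [Iy' Jz' ->]]].
  by exists (y - y'), (z - z'); split; [exact: idealB..|ring].
- move=> r _ [y [z [Iy Jz ->]]].
  by exists (r * y), (r * z); split; [exact: idealMl..|ring].
Qed.

Lemma subset_ideal_addl I J : is_ideal J -> I `<=` ideal_add I J.
Proof. by move=> IJ x Ix; exists x, 0; rewrite addr0; split=> //;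
  apply: ideal0. Qed.

Lemma subset_ideal_addr I J : is_ideal I -> J `<=` ideal_add I J.
Proof. by move=> II x Jx; exists 0, x; rewrite add0r; split=> //;
  apply: ideal0. Qed.

Definition principal r : set R := [set r' * r | r' in [set: R]].

Lemma is_ideal_principal r : is_ideal (principal r).
Proof.
split; first apply/zmod_closed_setP; first split.
- by exists 0 => //; rewrite mul0r.
- by move=> _ _ [y _ <-] [z _ <-]; exists (y - z) => //; ring.
- by move=> s _ [y _ <-]; exists (s * y) => //; ring.
Qed.

Lemma principal_id r : principal r r.
Proof. by exists 1 => //; rewrite mul1r. Qed.

(** * Homogeneous components *)

Hypothesis gradA : is_grading A.

Lemma grading0 g : A g 0.
Proof. by have /zmod_closed_setP[] := grading_zmod gradA g. Qed.

Lemma gradingB g x y : A g x -> A g y -> A g (x - y).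
Proof. by have /zmod_closed_setP[_] := grading_zmod gradA g; apply. Qed.

Lemma gradingD g x y : A g x -> A g y -> A g (x + y).
Proof.
move=> Ax Ay; rewrite -[y]opprK -[- y]sub0r; do 2?apply: gradingB => //.
exact: grading0.
Qed.

Lemma gradingM1 x y : A 1%g x -> A 1%g y -> A 1%g (x * y).
Proof. by rewrite -{3}(mulg1 1%g); apply: grading_mul. Qed.

Lemma hdecomp_subproof x : exists f : {fsfun G -> R with 0},
  (forall g, A g (f g)) /\ x = \sum_(g <- finsupp f) f g.
Proof.
by have [_ /(_ x Logic.I)[f [fP _]]] := grading_sum gradA; exists f.
Qed.

Definition hdecomp x : {fsfun G -> R with 0} := sval (cid (hdecomp_subproof x)).

Lemma hdecomp_in x g : A g (hdecomp x g).
Proof. by rewrite /hdecomp; case: cid => f []. Qed.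

Lemma hdecomp_sum x : x = \sum_(g <- finsupp (hdecomp x)) hdecomp x g.
Proof. by rewrite /hdecomp; case: cid => f []. Qed.

Lemma hdecomp_sum_sub x (K : {fset G}) : (finsupp (hdecomp x) `<=` K)%fset ->
  x = \sum_(g <- K) hdecomp x g.
Proof.
by move=> sK; rewrite {1}[x]hdecomp_sum;
  apply: big_fset_incl => // g _ /fsfun_dflt.
Qed.

Lemma hdecomp_uniq x (f : {fsfun G -> R with 0}) :
  (forall g, A g (f g)) -> x = \sum_(g <- finsupp f) f g -> hdecomp x = f.
Proof.
move=> fA fx; have [_ /(_ x Logic.I)[f0 [_ f0U]]] := grading_sum gradA.
rewrite -(f0U f)//; symmetry; apply: f0U; split; first exact: hdecomp_in.
exact: hdecomp_sum.
Qed.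

(** Uniqueness of decompositions: cutting [F] off outside [K] gives a finitely supported family. [K]
    may exceed the support, so supports need not be computed exactly. *)
Lemma hdecompE x (K : {fset G}) (F : G -> R) : (forall g, A g (F g)) ->
  x = \sum_(g <- K) F g -> forall g, hdecomp x g = if g \in K then F g else 0.
Proof.
move=> FA Fx g; pose f : {fsfun G -> R with 0} := [fsfun g in K => F g | 0].
have fE h : f h = if h \in K then F h else 0 by rewrite fsfunE.
rewrite -fE (@hdecomp_uniq x f)// => [h|].
  by rewrite fE; case: ifP => // _; apply: grading0.
rewrite Fx [RHS](@big_fset_incl _ _ _ _ _ K).
- by apply: eq_big_seq => h hK; rewrite fE hK.
- by apply: finsupp_sub.
- by move=> h _ /fsfun_dflt.
Qed.

Lemma hdecompD x y g : hdecomp (x + y) g = hdecomp x g + hdecomp y g.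
Proof.
set K := (finsupp (hdecomp x) `|` finsupp (hdecomp y))%fset.
rewrite (@hdecompE _ K (fun h => hdecomp x h + hdecomp y h)).
- case: ifPn => //;
    rewrite in_fsetU negb_or => /andP[/fsfun_dflt-> /fsfun_dflt->].
  by rewrite addr0.
- by move=> h; apply: gradingD; apply: hdecomp_in.
- by rewrite big_split/= -!hdecomp_sum_sub// ?fsubsetUl ?fsubsetUr.
Qed.

Lemma hdecomp_id x g : A g x -> hdecomp x g = x.
Proof.
move=> Ax;
  rewrite (@hdecompE _ [fset g]%fset (fun h => if h == g then x else 0)).
- by rewrite in_fset1 eqxx.
- by move=> h; case: eqP => [->|_] //; apply: grading0.
- by rewrite big_seq_fset1 eqxx.
Qed.

(** Multiplying by [r] of degree [g] shifts every degree by [g] on the right; this translation is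
    injective, so no two components merge. *)
Lemma hdecompMr x r g h : A g r ->
  hdecomp (x * r) h = hdecomp x (h * g^-1)%g * r.
Proof.
move=> Ar; set K := [fset (k * g)%g | k in finsupp (hdecomp x)]%fset.
rewrite (@hdecompE _ K (fun k => hdecomp x (k * g^-1)%g * r)).
- case: ifPn => // hK; rewrite fsfun_dflt ?mul0r//; apply: contra hK => hK.
  by apply/imfsetP; exists (h * g^-1)%g; rewrite ?mulgVK.
- move=> k; rewrite -{1}(mulgVK g k).
  by apply: grading_mul => //; apply: hdecomp_in.
- rewrite big_imfset/=; last by move=> k k' _ _ /mulIg.
  by rewrite {1}[x]hdecomp_sum mulr_suml; under [RHS]eq_bigr do rewrite mulgK.
Qed.

(** Comparing degree-[g] components in [1 * r = r] shows that the identity-degree component of 1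
    fixes each homogeneous [r], hence fixes every sum of such elements. *)
Lemma grading1 : A 1%g 1.
Proof.
suff <- : hdecomp 1 1%g = 1 by apply: hdecomp_in.
have e_id g r : A g r -> hdecomp 1 1%g * r = r.
  by move=> Ar; rewrite -{1}(mulgV g) -hdecompMr// mul1r hdecomp_id.
(* The element fixed here is 1 itself, expanded into its components. *)
rewrite -[LHS]mulr1 [X in _ * X = X]hdecomp_sum mulr_sumr.
by apply: eq_bigr => g _; apply: (e_id g); apply: hdecomp_in.
Qed.

(** * Graded ideals *)

Lemma graded_idealP I :
  graded_ideal A I <-> is_ideal I /\ forall x g, I x -> I (hdecomp x g).
Proof.
(* A decomposition inside [I] is also one in [R], so uniqueness identifies it with [hdecomp x]. *)
split=> [[II [_ Isum]]|[II Ih]]; split=> //.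
  move=> x g /Isum[f [[fIA fx] _]].
  rewrite (@hdecomp_uniq x f)//; first by case: (fIA g).
  by move=> h; case: (fIA h).
split=> [g x []//|x Ix]; exists (hdecomp x); split.
  by split; [move=> g; split; [exact: Ih|exact: hdecomp_in]|exact: hdecomp_sum].
by move=> f [fIA fx]; apply: hdecomp_uniq => // h; case: (fIA h).
Qed.

Lemma graded_ideal_hdecomp I x g : graded_ideal A I -> I x -> I (hdecomp x g).
Proof. by case/graded_idealP => _; apply. Qed.

Lemma graded_ideal_add I J :
  graded_ideal A I -> graded_ideal A J -> graded_ideal A (ideal_add I J).
Proof.
move=> gI gJ; apply/graded_idealP; split.
  by apply: is_ideal_add; [case: gI|case: gJ].
move=> _ g [y [z [Iy Jz ->]]]; exists (hdecomp y g), (hdecomp z g).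
by rewrite hdecompD; split=> //; apply: graded_ideal_hdecomp.
Qed.

Lemma graded_principal r : homogeneous A r -> graded_ideal A (principal r).
Proof.
move=> [g _ Ar]; apply/graded_idealP; split; first exact: is_ideal_principal.
by move=> _ h [x _ <-]; rewrite (hdecompMr _ _ Ar);
  exists (hdecomp x (h * g^-1)%g).
Qed.

Lemma graded_ideal0 : graded_ideal A [set 0].
Proof.
suff <- : principal 0 = [set 0].
  by apply: graded_principal; exists 1%g => //; apply: grading0.
apply/seteqP; split=> [_ [x _ <-]|_ ->]; first by rewrite /= mulr0.
exact: principal_id.
Qed.

(** * Zorn's lemma, graded maximal ideals and homogeneous primes *)

Lemma graded_ideal_directed_union (F : set (set R)) : F !=set0 ->
  (forall I, F I -> graded_ideal A I) ->
  (forall I J, F I -> F J -> exists K, [/\ F K, I `<=` K & J `<=` K]) ->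
  graded_ideal A (\bigcup_(I in F) I).
Proof.
move=> [I0 FI0] Fgr Fdir; have Fid I (FI : F I)
  : is_ideal I by case: (Fgr I FI).
apply/graded_idealP; split; first split.
- apply/zmod_closed_setP; split; first by exists I0 => //; apply: ideal0;
    apply: Fid.
  move=> x y [I FI Ix] [J FJ Jy]; have [K [FK IK JK]] := Fdir _ _ FI FJ.
  by exists K => //; apply: idealB; [exact: Fid|exact: IK|exact: JK].
- by move=> r x [I FI Ix]; exists I => //; apply: idealMl => //; apply: Fid.
- by move=> x g [I FI Ix]; exists I => //; apply: graded_ideal_hdecomp => //;
    apply: Fgr.
Qed.

(** Serves twice: [S = [set 1]] yields graded maximal ideals, a multiplicatively closed [S] yields
    homogeneous primes. *)
Lemma exists_maximal_disjoint S I : graded_ideal A I -> I `&` S = set0 ->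
  exists P, [/\ graded_ideal A P, I `<=` P, P `&` S = set0 &
    forall J, graded_ideal A J -> P `<=` J -> J `&` S = set0 -> J = P].
Proof.
move=> gI IS0; pose Q J := graded_ideal A J /\ J `&` S = set0.
(* Zorn_bigcup also requires the property for the union of the empty chain,
   so it is applied to the sets X such that I `|` X is an ideal avoiding S. *)
have [|X [[gP PS0] Xmax]] := @Zorn_bigcup R [set X | Q (I `|` X)].
  move=> F FQ Ftot; have [->|/set0P[X0 FX0]] := eqVneq F set0.
    by rewrite bigcup_set0 /= setU0.
  rewrite /=.
  (* The member [X0] is what lets [I] be absorbed into the union. *)
  have -> : I `|` \bigcup_(X in F) X = \bigcup_(J in [set I `|` X | X in F]) J.
    apply/seteqP; split=> [x [Ix|[X FX Xx]]|x [_ [X FX <-] [Ix|Xx]]].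
    - by exists (I `|` X0); [exists X0|left].
    - by exists (I `|` X); [exists X|right].
    - by left.
    - by right; exists X.
  split.
    apply: graded_ideal_directed_union.
    - by exists (I `|` X0), X0.
    - by move=> _ [X FX <-]; case: (FQ X FX).
    - move=> _ _ [X FX <-] [Y FY <-].
      have [XY|YX] := Ftot X Y FX FY.
        by exists (I `|` Y); split=> //; [exists Y|apply: setUS].
      by exists (I `|` X); split=> //; [exists X|apply: setUS].
  rewrite setI_bigcupl; apply: bigcup0 => _ [X FX <-].
  by case: (FQ X FX).
exists (I `|` X); split=> // J gJ PJ JS0.
have [IJ XJ] : I `<=` J /\ X `<=` J.
  by split=> x ?; apply: PJ; [left|right].
(* Maximality concerns [X], not the union of [I] and [X]; as [J] contains [I], [J] itself is a
   candidate for comparison with [X]. *)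
have [->|nXJ] := pselect (X = J); first by rewrite ((setUidPr _ _).2 IJ).
exfalso; apply: (Xmax J); last by rewrite /= ((setUidPr _ _).2 IJ).
by split=> // JX; apply: nXJ; apply/seteqP.
Qed.

Lemma graded_maximal_above I : graded_ideal A I -> ~ I 1 ->
  exists2 M, graded_maximal A M & I `<=` M.
Proof.
have dis1 J : (J `&` [set 1] = set0) <-> ~ J 1.
  split=> [J0 J1|J1]; first by have : (J `&` [set 1]) 1 by []; rewrite J0.
  by apply/seteqP; split=> // x [Jx /= x1]; apply: J1; rewrite -x1.
move=> gI /dis1 /(exists_maximal_disjoint gI)[M [gM IM /dis1 M1 Mmax]].
exists M => //; split=> // [MT|J gJ JT MJ]; first by apply: M1; rewrite MT.
by apply: Mmax => //; apply/dis1 => J1; apply/JT/ideal1 => //; case: gJ.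
Qed.

(** A proper sum would equal both [M] and [N] by their maximality. *)
Lemma graded_maximal_comaximal M N : graded_maximal A M -> graded_maximal A N ->
  M <> N -> ideal_add M N 1.
Proof.
move=> [gM MT Mmax] [gN NT Nmax] MN; apply: contra_notP MN => MN1.
have [IM IN] : is_ideal M /\ is_ideal N by case: gM; case: gN.
have MNT : ideal_add M N <> [set: R] by move=> e; apply: MN1; rewrite e.
have gMN := graded_ideal_add gM gN.
rewrite -(Mmax _ gMN MNT (subset_ideal_addl IN)).
exact: (Nmax _ gMN MNT (subset_ideal_addr IM)).
Qed.

(** If homogeneous [r] and [s] lie outside [P], then [P + Rr] and [P + Rs] are strictly larger
    graded ideals, so both meet [S]. Were [r * s] in [P], the product of the two elements found
    would lie in both [P] and [S]. *)
Lemma homogeneous_prime_maximal_disjoint S P : S 1 ->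
  (forall x y, S x -> S y -> S (x * y)) ->
  graded_ideal A P -> P `&` S = set0 ->
  (forall J, graded_ideal A J -> P `<=` J -> J `&` S = set0 -> J = P) ->
  homogeneous_prime A P.
Proof.
move=> S1 SM gP PS0 Pmax; have IP : is_ideal P by case: gP.
have PSF x : P x -> S x -> False.
  by move=> Px Sx; have : (P `&` S) x by []; rewrite PS0.
have meetS r : homogeneous A r -> ~ P r ->
    exists p x, P p /\ S (p + x * r).
  move=> hr Pr; apply: contra_notP Pr => noS.
  have Ir := is_ideal_principal r.
  rewrite -(Pmax (ideal_add P (principal r))).
  - by apply: subset_ideal_addr => //; apply: principal_id.
  - by apply: graded_ideal_add => //; apply: graded_principal.
  - exact: subset_ideal_addl.
  - apply/seteqP; split=> // _ [[p [_ [Pp [x _ <-] ->]]] Sx].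
    by apply: noS; exists p, x.
split=> // [PT|r s hr hs Prs]; first by apply: (PSF 1) => //; rewrite PT.
apply: contrapT => /not_orP[/(meetS _ hr)[p [x [Pp Sp]]]
  /(meetS _ hs)[q [y [Pq Sq]]]].
apply: (PSF _ _ (SM _ _ Sp Sq)).
have -> : (p + x * r) * (q + y * s) =
    (q + y * s) * p + (x * r) * q + (x * y) * (r * s).
  by ring.
by do 2?apply: idealD => //; apply: idealMl.
Qed.

End GradedRing.

(** * The Gelfand property and the factorization of zero *)

Theorem theorem2p14 (G : groupType) (R : comPzRingType) (A : G -> set R)
    (gradA : is_grading A) :
  gelfand_graded A <->
  (forall a : R, A 1%g a ->
     exists b c : R, [/\ A 1%g b, A 1%g c &
       let a' := 1 - a in (1 - b * a) * (1 - c * a') = 0]).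
Proof.
have A1 := grading1 gradA.
have homA1 x : A 1%g x -> homogeneous A x by exists 1%g.
split=> [gelfA a Aa|H P [gP PT Pprime]].
- pose a' := 1 - a; have Aa' : A 1%g a' by apply: (gradingB gradA).
  pose S := [set x | exists b c, [/\ A 1%g b, A 1%g c &
    x = (1 - b * a) * (1 - c * a')]].
  apply: contrapT => nS0.
  have S1 : S 1 by exists 0, 0; split; [exact: grading0..|ring].
  have SM x y : S x -> S y -> S (x * y).
    move=> [b [c [Ab Ac ->]]] [d [e [Ad Ae ->]]].
    (* From [(1 - b * a) * (1 - d * a) = 1 - (b + d - b * d * a) * a], and likewise for [a']. *)
    exists (b + d - b * d * a), (c + e - c * e * a'); split; last by ring.
    - by apply: (gradingB gradA);
        [exact: (gradingD gradA)|do 2?apply: (gradingM1 gradA)].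
    - by apply: (gradingB gradA);
        [exact: (gradingD gradA)|do 2?apply: (gradingM1 gradA)].
  have S0 : [set 0] `&` S = set0.
    apply/seteqP; split=> // _ [->] [b [c [Ab Ac bc0]]].
    by apply: nS0; exists b, c.
  have [P [gP _ PS0 Pmax]]
    := exists_maximal_disjoint gradA (graded_ideal0 gradA) S0.
  have Pprime := homogeneous_prime_maximal_disjoint gradA S1 SM gP PS0 Pmax.
  have IP : is_ideal P by case: gP.
  have above t : A 1%g t -> (forall b, A 1%g b -> S (1 - b * t)) ->
      exists M, [/\ graded_maximal A M, P `<=` M & M t].
    move=> At St; have It := is_ideal_principal t.
    have gJ : graded_ideal A (ideal_add P (principal t)).
      by apply: graded_ideal_add => //; apply: graded_principal; auto.
    have [|M mM JM] := graded_maximal_above gradA gJ.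
      move=> [p [_ [Pp [x _ <-] e]]].
      (* Identity-degree components of [1 = p + x * t] show that this element is the component of
         [p], hence in [P]. *)
      have : (P `&` S) (1 - hdecomp gradA x 1%g * t).
        split; last by apply: St; apply: hdecomp_in.
        rewrite -{1}(hdecomp_id gradA A1) e hdecompD (hdecompMr _ _ _ At).
        by rewrite invg1 mulg1 addrK; apply: graded_ideal_hdecomp.
      by rewrite PS0.
    exists M; split=> //; first by move=> x Px; apply: JM;
      apply: subset_ideal_addl.
    by apply: JM; apply: subset_ideal_addr => //; apply: principal_id.
  have [|M [mM PM Ma]] := above a Aa.
    (* A zero coefficient makes the other factor 1. *)
    by move=> b Ab; exists b, 0; split=> //; [exact: grading0|ring].
  have [|N [mN PN Na']] := above a' Aa'.
    by move=> b Ab; exists 0, b; split=> //; [exact: grading0|ring].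
  have [L [_ LU]] := gelfA P Pprime.
  have MN : M = N by rewrite -(LU M)// -(LU N).
  have [[IM _] MT _] := mM; apply: MT; apply: ideal1 => //.
  have -> : 1 = a + a' by rewrite /a'; ring.
  by apply: idealD => //; rewrite MN.
- have IP : is_ideal P by case: gP.
  have P1 : ~ P 1 by move=> /(ideal1 IP).
  have [M mM PM] := graded_maximal_above gradA gP P1.
  exists M; split=> // N [mN PN]; apply: contrapT => MN.
  have [x [y [Mx Ny xy1]]] := graded_maximal_comaximal gradA mM mN MN.
  have [[gM MT _] [gN NT _]] := (mM, mN).
  have [IM IN] : is_ideal M /\ is_ideal N by case: gM; case: gN.
  (* The hypothesis only covers identity degree, so [1 = x + y] is replaced by its component there;
     [1 - a] is then the component of [y]. *)
  pose a := hdecomp gradA x 1%g; have Aa : A 1%g a by apply: hdecomp_in.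
  have Ma : M a by apply: graded_ideal_hdecomp.
  have Na' : N (1 - a).
    rewrite -{1}(hdecomp_id gradA A1) xy1 hdecompD addrC addKr.
    exact: graded_ideal_hdecomp.
  have [b [c [Ab Ac /= bc0]]] := H a Aa.
  have [||||] := Pprime (1 - b * a) (1 - c * (1 - a)).
  + by apply: homA1; apply: (gradingB gradA) => //; apply: (gradingM1 gradA).
  + by apply: homA1; apply: (gradingB gradA) => //;
      apply: (gradingM1 gradA) => //; apply: (gradingB gradA).
  + by rewrite bc0; apply: ideal0.
  + move=> /PM Mb; apply/MT/ideal1 => //.
    by rewrite -(subrK (b * a) 1); apply: idealD => //; apply: idealMl.
  + move=> /PN Nc; apply/NT/ideal1 => //.
    by rewrite -(subrK (c * (1 - a)) 1); apply: idealD => //; apply: idealMl.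
Qed.
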